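(* Assume $\psi_1>0$ and $\psi_2<0$. Suppose that the system (EL) in the context admits a solution $\rho$ (with multiplier $P_0\in\mathbb{R}$), and let $(x(\theta),y(\theta))=(\rho(\theta)\cos\theta,\rho(\theta)\sin\theta)$ be the corresponding free boundary curve with slope angle $\psi(\theta)$. Then the angle $\psi$ is a global parameter of the curve: the map $\theta\mapsto\psi(\theta)$, $\theta\in[\theta_2,\pi-\theta_1]$, is one-to-one. Moreover, using $\psi$ as parametrization variable of the boundary curve, the system (EL) is equivalent to the system $$\frac{dx}{d\psi}=\sigma\frac{\cos\psi}{gy-P_0},\qquad \frac{dy}{d\psi}=\sigma\frac{\sin\psi}{gy-P_0},\qquad \psi(\pi-\theta_1)=\psi_1,\qquad \psi(\theta_2)=\psi_2 .$$ In particular the solution curve, parametrized by $\psi$, satisfies this system.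
   Context: Let $g>0$, $\sigma>0$, $\theta_1,\theta_2\in(0,\pi)$ with $\theta_1+\theta_2<\pi$, and let $[\![\gamma]\!]\in\mathbb{R}$ satisfy $-1\le [\![\gamma]\!]/\sigma\le 1$. Define $\gamma\in[-\frac{\pi}{2},\frac{\pi}{2}]$ by $\sin\gamma=-[\![\gamma]\!]/\sigma$, and $\psi_1:=\gamma+\frac{\pi}{2}-\theta_1$, $\psi_2:=-\gamma-\frac{\pi}{2}+\theta_2$. The fluid lies between two walls, the rays from the origin with polar angles $\theta_2$ (right wall) and $\pi-\theta_1$ (left wall); the free surface is the polar graph of a positive $C^2$ function $\rho$ on $[\theta_2,\pi-\theta_1]$. System (EL), for $\rho$ and a constant $P_0\in\mathbb{R}$: $$g\rho^2\sin\theta+\sigma\frac{\rho}{\sqrt{\rho^2+\rho'^2}}-\sigma\,\partial_\theta\Big(\frac{\rho'}{\sqrt{\rho^2+\rho'^2}}\Big)-P_0\rho=0\quad\text{on }(\theta_2,\pi-\theta_1),$$ $$\frac{\rho'}{\sqrt{\rho^2+\rho'^2}}(\theta_2)=-\frac{[\![\gamma]\!]}{\sigma},\qquad \frac{\rho'}{\sqrt{\rho^2+\rho'^2}}(\pi-\theta_1)=\frac{[\![\gamma]\!]}{\sigma}.$$ The slope angle $\psi(\theta)$ is the tangent angle of the curve traversed from left to right (that is, with decreasing $\theta$): it is the continuous function with $\psi(\theta)\in(\theta-\pi,\theta)$ and $$\sin\psi=-\frac{\rho'\sin\theta+\rho\cos\theta}{\sqrt{\rho^2+\rho'^2}},\qquad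 \cos\psi=\frac{\rho\sin\theta-\rho'\cos\theta}{\sqrt{\rho^2+\rho'^2}}.$$ ''Equivalent'' means: for a positive $C^2$ function $\rho$ for which $\theta\mapsto\psi(\theta)$ is one-to-one, so that the curve may be written as $(x(\psi),y(\psi))$, $\rho$ satisfies (EL) if and only if $(x(\psi),y(\psi))$ satisfies the displayed $\psi$-system, where $\psi(\pi-\theta_1)$ and $\psi(\theta_2)$ are the slope angles at the left and right walls. *)

(* Defs.v *)
From Stdlib Require Import Reals Lra.
From Coquelicot Require Import Coquelicot.
Open Scope R_scope.

Definition Icc (a b t : R) : Prop := a <= t <= b.

(* rho is C^2 on the closed interval [a, b], with first and second derivatives
   drho and ddrho.  Stdlib's D_in and continue_in are relative to the set
   [a, b], hence one-sided at the end points: the values of rho outside [a, b]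
   play no role. *)
Definition C2_on (a b : R) (rho drho ddrho : R -> R) : Prop :=
  forall t, Icc a b t ->
    D_in rho drho (Icc a b) t /\
    D_in drho ddrho (Icc a b) t /\
    continue_in ddrho (Icc a b) t.

Definition positive_on (a b : R) (rho : R -> R) : Prop :=
  forall t, Icc a b t -> 0 < rho t.

Definition injective_on (a b : R) (f : R -> R) : Prop :=
  forall s t, Icc a b s -> Icc a b t -> f s = f t -> s = t.

Definition speed (rho drho : R -> R) (t : R) : R :=
  sqrt (rho t ^ 2 + drho t ^ 2).

(* System (EL); jump stands for [[gamma]].  For rho of class C^2 and positive
   on the closed interval, the function under Derive is differentiable at each
   interior point. *)
Definition EL (g sigma jump theta1 theta2 P0 : R) (rho drho : R -> R) : Prop :=
  (forall t, theta2 < t < PI - theta1 ->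
     g * rho t ^ 2 * sin t
     + sigma * (rho t / speed rho drho t)
     - sigma * Derive (fun s => drho s / speed rho drho s) t
     - P0 * rho t = 0) /\
  drho theta2 / speed rho drho theta2 = - (jump / sigma) /\
  drho (PI - theta1) / speed rho drho (PI - theta1) = jump / sigma.

Definition slope_angle (a b : R) (rho drho psi : R -> R) : Prop :=
  forall t, Icc a b t ->
    continue_in psi (Icc a b) t /\
    t - PI < psi t < t /\
    sin (psi t) = - ((drho t * sin t + rho t * cos t) / speed rho drho t) /\
    cos (psi t) = (rho t * sin t - drho t * cos t) / speed rho drho t.

Definition psi_range (a b : R) (psi : R -> R) (p : R) : Prop :=
  exists t, Icc a b t /\ psi t = p.

(* (x, y), as a function of the slope angle, is the polar graph of rho. *)
Definition psi_param (a b : R) (rho psi x y : R -> R) : Prop :=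
  forall t, Icc a b t ->
    x (psi t) = rho t * cos t /\ y (psi t) = rho t * sin t.

(* The non-vanishing of the denominator, implicit in the quotients, is part of
   the system.  At the two end points of the parameter range the derivatives
   are one-sided. *)
Definition psi_system (g sigma theta1 theta2 psi1 psi2 P0 : R)
    (psi x y : R -> R) : Prop :=
  let J := psi_range theta2 (PI - theta1) psi in
  (forall p, J p ->
     g * y p - P0 <> 0 /\
     D_in x (fun q => sigma * (cos q / (g * y q - P0))) J p /\
     D_in y (fun q => sigma * (sin q / (g * y q - P0))) J p) /\
  psi (PI - theta1) = psi1 /\
  psi theta2 = psi2.

Lemma limit1_in_continuity_comp (h f : R -> R) (D : R -> Prop) (l x : R) :
  limit1_in f D l x -> continuity_pt h l ->
  limit1_in (fun t => h (f t)) D (h l) x.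
Proof.
intros Hf Hh e He.
destruct (Hh e He) as [d [Hd Hd']].
destruct (Hf d Hd) as [d1 [Hd1 Hd1']].
exists d1; split; [exact Hd1|]. intros t Ht.
destruct (Req_dec l (f t)) as [E|E].
- rewrite <- E. simpl. rewrite (proj2 (R_dist_refl _ _) eq_refl). exact He.
- apply Hd'. split; [split; [exact I|exact E]|]. apply Hd1'; exact Ht.
Qed.

Lemma slope_angle_exists (a b : R) (rho drho ddrho : R -> R) :
  C2_on a b rho drho ddrho -> positive_on a b rho ->
  slope_angle a b rho drho (fun t => t - PI / 2 - atan (drho t / rho t)).
Proof.
intros HC Hp t Ht.
destruct (HC t Ht) as [H1 [H2 _]]. pose proof (Hp t Ht) as Hr.
assert (Hs : speed rho drho t = rho t * sqrt (1 + (drho t / rho t) ^ 2)).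
{ unfold speed.
  replace (rho t ^ 2 + drho t ^ 2)
    with (rho t ^ 2 * (1 + (drho t / rho t) ^ 2)) by (field; lra).
  rewrite sqrt_mult_alt by nra. rewrite sqrt_pow2 by lra. reflexivity. }
assert (Hq : 0 < sqrt (1 + (drho t / rho t) ^ 2)).
{ apply sqrt_lt_R0. pose proof (pow2_ge_0 (drho t / rho t)). lra. }
assert (Es : sin (t - PI / 2 - atan (drho t / rho t))
   = - (sin t * sin (atan (drho t / rho t)) + cos t * cos (atan (drho t / rho t)))).
{ rewrite sin_minus, sin_minus, cos_minus, cos_PI2, sin_PI2. ring. }
assert (Ec : cos (t - PI / 2 - atan (drho t / rho t))
   = sin t * cos (atan (drho t / rho t)) - cos t * sin (atan (drho t / rho t))).
{ rewrite cos_minus, cos_minus, sin_minus, cos_PI2, sin_PI2. ring. }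
split; [|split; [|split]].
- apply limit_minus.
  + apply limit_minus; [apply lim_x|].
    intros e He; exists 1; split; [lra|]; intros y _.
    simpl; rewrite (proj2 (R_dist_refl _ _) eq_refl); exact He.
  + apply (limit1_in_continuity_comp atan (fun s => drho s / rho s)).
    * apply limit_mul; [apply (cont_deriv _ _ _ _ H2)|].
      apply limit_inv; [apply (cont_deriv _ _ _ _ H1)|lra].
    * apply derivable_continuous_pt, derivable_pt_atan.
- pose proof (atan_bound (drho t / rho t)). lra.
- rewrite Es, Hs, sin_atan, cos_atan.
  rewrite ?Rsqr_pow2 in *. field; split; lra.
- rewrite Ec, Hs, sin_atan, cos_atan.
  rewrite ?Rsqr_pow2 in *. field; split; lra.
Qed.

(* Main.v *)
Require Import Defs.
From Stdlib Require Import Reals Lra.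
From Stdlib Require ClassicalEpsilon.
From Coquelicot Require Import Coquelicot.
Open Scope R_scope.

(* Here [psi = t - PI / 2 - atan (rho' / rho)], the left-hand side of the equation
   of (EL) is [rho * (sigma * psi' / s - q)] with [s] the speed and
   [q = P0 - g y], and the boundary conditions are [psi = psi2], [psi = psi1] at
   the end points.  So (EL) amounts to [psi' = s q / sigma]; together with
   [q' = g s sin psi] this is an inverted pendulum, along which [psi * q] is
   nondecreasing because [psi] stays in [(-PI, PI)].  Since [psi] goes from
   [psi2 < 0] to [psi1 > 0], this forces [q > 0], hence [psi' > 0].  Dividing
   [x' = - s cos psi] and [y' = - s sin psi] by [psi'] gives the psi-system, and
   the chain rule recovers [psi'] from it. *)

(** * One-sided derivatives at end points and elementary calculus on an interval *)

(** Continuing [f] by its tangent lines beyond [a] and [b] turns the one-sided derivatives at the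
    end points into two-sided ones, so that [is_derive] and [auto_derive] can be used on the whole
    closed interval. *)
Lemma derivable_extension (a b : R) (f df : R -> R) :
  a < b -> (forall t, Icc a b t -> D_in f df (Icc a b) t) ->
  exists F : R -> R, forall t, Icc a b t -> F t = f t /\ is_derive F t (df t).
Proof.
intros Hab Hf.
set (F := fun t => if Rlt_dec t a then f a + df a * (t - a)
                   else if Rlt_dec b t then f b + df b * (t - b) else f t).
assert (HF : forall t, Icc a b t -> F t = f t).
{ intros t [H1 H2]; unfold F.
  destruct (Rlt_dec t a); [lra|]; destruct (Rlt_dec b t); [lra|]; reflexivity. }
exists F; intros t Ht; split; [now apply HF|].
apply is_derive_Reals; intros e He.
destruct (Hf t Ht e He) as [d [Hd Hd']].
assert (Hin : forall h, h <> 0 -> Rabs h < d -> Icc a b (t + h) ->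
   Rabs ((F (t + h) - F t) / h - df t) < e).
{ intros h Hh Hhd Hi. rewrite (HF _ Hi), (HF _ Ht).
  assert (E : t + h - t = h) by ring.
  assert (K : D_x (Icc a b) t (t + h) /\ R_dist (t + h) t < d).
  { split; [split; [exact Hi|lra]|]. unfold R_dist; now rewrite E. }
  generalize (Hd' _ K); simpl; unfold R_dist; now rewrite E. }
(* A small increment leaves the interval only from an end point and outwards, where [F] is affine.
   At an end point the radius is kept below [b - a], so that the opposite end is not reached. *)
assert (Hm : exists d' : posreal, d' <= d /\ forall h, Rabs h < d' ->
   Icc a b (t + h) \/ (t = a /\ h < 0) \/ (t = b /\ 0 < h)).
{ destruct Ht as [[H1|H1] [H2|H2]]; try lra.
  - assert (P : 0 < Rmin d (Rmin (t - a) (b - t))).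
    { repeat apply Rmin_glb_lt; lra. }
    exists (mkposreal _ P); simpl.
    pose proof (Rmin_l d (Rmin (t - a) (b - t))).
    pose proof (Rmin_r d (Rmin (t - a) (b - t))).
    pose proof (Rmin_l (t - a) (b - t)). pose proof (Rmin_r (t - a) (b - t)).
    split; [lra|]. intros h Hh; apply Rabs_def2 in Hh. left; unfold Icc; lra.
  - assert (P : 0 < Rmin d (b - a)) by (apply Rmin_glb_lt; lra).
    exists (mkposreal _ P); simpl.
    pose proof (Rmin_l d (b - a)). pose proof (Rmin_r d (b - a)).
    split; [lra|]. intros h Hh; apply Rabs_def2 in Hh.
    destruct (Rlt_dec 0 h); [right; right; lra|left; unfold Icc; lra].
  - assert (P : 0 < Rmin d (b - a)) by (apply Rmin_glb_lt; lra).
    exists (mkposreal _ P); simpl.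
    pose proof (Rmin_l d (b - a)). pose proof (Rmin_r d (b - a)).
    split; [lra|]. intros h Hh; apply Rabs_def2 in Hh.
    destruct (Rlt_dec h 0); [right; left; lra|left; unfold Icc; lra]. }
destruct Hm as [d' [Hdd Hm]]. exists d'. intros h Hh Hhd.
destruct (Hm h Hhd) as [Hi|[[E Hneg]|[E Hpos]]].
- apply Hin; auto; lra.
- rewrite (HF t Ht); subst t. unfold F.
  destruct (Rlt_dec (a + h) a); [|lra].
  replace ((f a + df a * (a + h - a) - f a) / h - df a) with 0 by (field; lra).
  now rewrite Rabs_R0.
- rewrite (HF t Ht); subst t. unfold F.
  destruct (Rlt_dec (b + h) a); [lra|]. destruct (Rlt_dec b (b + h)); [|lra].
  replace ((f b + df b * (b + h - b) - f b) / h - df b) with 0 by (field; lra).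
  now rewrite Rabs_R0.
Qed.

Lemma is_derive_continuity_pt (f : R -> R) (t l : R) :
  is_derive f t l -> continuity_pt f t.
Proof.
intros H. apply continuity_pt_filterlim, (ex_derive_continuous f). now exists l.
Qed.

Lemma is_derive_D_in (f df : R -> R) (D : R -> Prop) (t : R) :
  is_derive f t (df t) -> D_in f df D t.
Proof.
intros H. apply is_derive_Reals, derivable_pt_lim_D_in in H.
intros e He. destruct (H e He) as [d [Hd Hd']]. exists d; split; [exact Hd|].
intros u [[_ Hu] Hdu]. apply Hd'. now repeat split.
Qed.

Lemma mean_value (f df : R -> R) (a b : R) :
  a < b -> (forall t, a <= t <= b -> is_derive f t (df t)) ->
  exists c, a <= c <= b /\ f b - f a = df c * (b - a).
Proof.
intros Hab H.
destruct (MVT_gen f a b df) as [c [Hc E]].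
- intros t; rewrite Rmin_left, Rmax_right by lra. intros; apply H; lra.
- intros t; rewrite Rmin_left, Rmax_right by lra.
  intros; apply (is_derive_continuity_pt f t (df t)), H; lra.
- rewrite Rmin_left, Rmax_right in Hc by lra. now exists c.
Qed.

Lemma nondecreasing_of_derive (f df : R -> R) (a b : R) :
  a <= b -> (forall t, a <= t <= b -> is_derive f t (df t)) ->
  (forall t, a <= t <= b -> 0 <= df t) -> f a <= f b.
Proof.
intros [Hab|Hab] H Hd; [|rewrite Hab; lra].
destruct (mean_value f df a b Hab H) as [c [Hc E]].
pose proof (Hd c Hc). nra.
Qed.

Lemma intermediate_zero (f df : R -> R) (a b : R) :
  a < b -> (forall t, a <= t <= b -> is_derive f t (df t)) ->
  f a * f b <= 0 -> exists c, a <= c <= b /\ f c = 0.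
Proof.
intros Hab H Hs.
assert (C : forall t, a <= t <= b -> continuity_pt f t).
{ intros t Ht; apply (is_derive_continuity_pt f t (df t)), H, Ht. }
destruct (Req_dec (f a) 0); [exists a; lra|].
destruct (Req_dec (f b) 0); [exists b; lra|].
destruct (Rlt_dec (f a) 0).
- destruct (Ranalysis5.IVT_interv f a b C Hab) as [c Hc]; [lra|nra|].
  now exists c.
- destruct (Ranalysis5.IVT_interv (fun t => - f t) a b) as [c [Hc E]];
    [|lra|lra|nra|exists c; split; lra].
  intros t Ht. now apply continuity_pt_opp, C.
Qed.

(** * The inverted pendulum *)

Lemma mul_sin_nonneg (p : R) : - PI < p < PI -> 0 <= p * sin p.
Proof.
intros Hp. destruct (Rle_dec 0 p).
- apply Rmult_le_pos; [lra|]. apply sin_ge_0; lra.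
- pose proof (sin_ge_0 (- p)). rewrite sin_neg in *. nra.
Qed.

Lemma sin_sqr_le (p : R) : - PI < p < PI -> sin p ^ 2 <= p ^ 2.
Proof.
intros Hp. destruct (Rtotal_order p 0) as [H|[H|H]].
- pose proof (sin_lt_x (- p)). pose proof (sin_gt_0 (- p)).
  rewrite sin_neg in *. nra.
- subst p. rewrite sin_0. lra.
- pose proof (sin_lt_x p H). pose proof (sin_gt_0 p). nra.
Qed.

(* Gronwall's inequality for [p^2 + q^2]. *)
Lemma pendulum_rest (s p q : R -> R) (sigma g c b : R) :
  0 < sigma -> 0 < g -> c <= b ->
  (forall t, c <= t <= b -> 0 < s t /\ continuity_pt s t) ->
  (forall t, c <= t <= b -> is_derive p t (s t / sigma * q t)) ->
  (forall t, c <= t <= b -> is_derive q t (g * s t * sin (p t))) ->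
  (forall t, c <= t <= b -> - PI < p t < PI) ->
  p c = 0 -> q c = 0 -> p b = 0.
Proof.
intros Hsig Hg Hcb Hs Hp Hq Hr Hpc Hqc.
destruct (continuity_ab_maj s c b Hcb (fun t Ht => proj2 (Hs t Ht)))
  as [m [Hm Hmi]].
(* With [s m] the maximum of [s] and [sin p ^ 2 <= p ^ 2], the derivative of [p ^ 2 + q ^ 2] is at
   most [K * (p ^ 2 + q ^ 2)]. Hence the weight [exp (- K * t)] makes the product nonincreasing; the
   sign is reversed below to fit [nondecreasing_of_derive]. *)
set (K := s m * (/ sigma + g)).
assert (Hi : 0 < / sigma) by now apply Rinv_0_lt_compat.
assert (H : - (p c ^ 2 + q c ^ 2) * exp (- K * c)
            <= - (p b ^ 2 + q b ^ 2) * exp (- K * b)).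
{ apply (nondecreasing_of_derive
    (fun t => - (p t ^ 2 + q t ^ 2) * exp (- K * t))
    (fun t => (K * (p t ^ 2 + q t ^ 2)
      - 2 * s t * (/ sigma * (p t * q t) + g * (q t * sin (p t))))
      * exp (- K * t)) c b Hcb).
  - intros t Ht. pose proof (Hp t Ht) as Dp. pose proof (Hq t Ht) as Dq.
    evar_last.
    + auto_derive; [|reflexivity].
      repeat split; [now exists (s t / sigma * q t)
                    |now exists (g * s t * sin (p t))].
    + replace (Derive (fun x : R => p x) t) with (s t / sigma * q t)
        by (symmetry; now apply is_derive_unique).
      replace (Derive (fun x : R => q x) t) with (g * s t * sin (p t))
        by (symmetry; now apply is_derive_unique).
      field. lra.
  - intros t Ht. apply Rmult_le_pos; [|left; apply exp_pos].
    pose proof (sin_sqr_le _ (Hr t Ht)) as Hsin.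
    destruct (Hs t Ht) as [Hst _]. pose proof (Hm t Ht) as Hstm.
    assert (E1 : 2 * (p t * q t) <= p t ^ 2 + q t ^ 2)
      by (pose proof (pow2_ge_0 (p t - q t)); lra).
    assert (E2 : 2 * (q t * sin (p t)) <= p t ^ 2 + q t ^ 2)
      by (pose proof (pow2_ge_0 (q t - sin (p t))); lra).
    assert (E3 : 2 * (/ sigma * (p t * q t) + g * (q t * sin (p t)))
                 <= (/ sigma + g) * (p t ^ 2 + q t ^ 2)) by nra.
    assert (E4 : 0 <= (/ sigma + g) * (p t ^ 2 + q t ^ 2)).
    { apply Rmult_le_pos; [lra|]. pose proof (pow2_ge_0 (p t)).
      pose proof (pow2_ge_0 (q t)). lra. }
    unfold K. nra. }
rewrite Hpc, Hqc in H. pose proof (exp_pos (- K * b)).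
pose proof (pow2_ge_0 (p b)). pose proof (pow2_ge_0 (q b)).
assert (p b ^ 2 + q b ^ 2 <= 0) by nra.
nra.
Qed.

(* [p * q] is nondecreasing, so [p ^ 2] is least at a zero of [q]; as [p]
   changes sign, [p] would vanish there together with [q], and hence
   everywhere. *)
Lemma pendulum_monotone (s p q : R -> R) (sigma g a b : R) :
  0 < sigma -> 0 < g -> a < b ->
  (forall t, a <= t <= b -> 0 < s t /\ continuity_pt s t) ->
  (forall t, a <= t <= b -> is_derive p t (s t / sigma * q t)) ->
  (forall t, a <= t <= b -> is_derive q t (g * s t * sin (p t))) ->
  (forall t, a <= t <= b -> - PI < p t < PI) ->
  p a < 0 < p b ->
  forall t, a <= t <= b -> 0 < q t.
Proof.
intros Hsig Hg Hab Hs Hp Hq Hr Hpab.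
assert (Hs' : forall t, a <= t <= b -> 0 < s t / sigma).
{ intros t Ht. apply Rdiv_lt_0_compat; [|lra]. now apply Hs. }
(* The derivative of [p * q] is [s / sigma * q ^ 2 + g * s * (p * sin p)], a sum of two nonnegative
   terms. *)
assert (Hmono : forall u v, a <= u -> u <= v -> v <= b -> p u * q u <= p v * q v).
{ intros u v Hu Huv Hv.
  apply (nondecreasing_of_derive (fun t => p t * q t)
    (fun t => s t / sigma * q t * q t + p t * (g * s t * sin (p t))) u v Huv).
  - intros t Ht. apply (is_derive_mult p q t); [apply Hp|apply Hq|exact Rmult_comm]; lra.
  - intros t Ht. pose proof (Hs' t ltac:(lra)).
    destruct (Hs t ltac:(lra)) as [Hst _].
    pose proof (mul_sin_nonneg _ (Hr t ltac:(lra))).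
    pose proof (Rle_0_sqr (q t)) as Hq2; unfold Rsqr in Hq2.
    assert (0 <= s t / sigma * (q t * q t)) by (apply Rmult_le_pos; lra).
    assert (0 <= g * s t * (p t * sin (p t))).
    { apply Rmult_le_pos; [apply Rmult_le_pos; lra|lra]. }
    lra. }
assert (Dp2 : forall t, a <= t <= b ->
  is_derive (fun t => p t * p t) t (2 * (s t / sigma) * (p t * q t))).
{ intros t Ht. evar_last.
  - apply (is_derive_mult p p t); [apply Hp|apply Hp|exact Rmult_comm]; lra.
  - unfold plus, mult; simpl. ring. }
assert (Hnz : forall c, a <= c <= b -> q c <> 0).
{ intros c Hc Eq.
  (* The derivative of [p ^ 2] has the sign of [p * q], which is zero at [c], hence nonpositive
     before [c] and nonnegative after it. *)
  assert (Hmin : forall t, a <= t <= b -> p c * p c <= p t * p t).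
  { intros t Ht. destruct (Rle_dec c t) as [H|H].
    - apply (nondecreasing_of_derive (fun t => p t * p t)
        (fun t => 2 * (s t / sigma) * (p t * q t)) c t H).
      + intros u Hu; apply Dp2; lra.
      + intros u Hu. pose proof (Hs' u ltac:(lra)).
        pose proof (Hmono c u ltac:(lra) ltac:(lra) ltac:(lra)) as M.
        rewrite Eq, Rmult_0_r in M. apply Rmult_le_pos; lra.
    - apply Ropp_le_cancel.
      apply (nondecreasing_of_derive (fun t => - (p t * p t))
        (fun t => - (2 * (s t / sigma) * (p t * q t))) t c); [lra| |].
      + intros u Hu. apply (is_derive_opp (fun t => p t * p t)), Dp2; lra.
      + intros u Hu. pose proof (Hs' u ltac:(lra)).
        pose proof (Hmono u c ltac:(lra) ltac:(lra) ltac:(lra)) as M.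
        rewrite Eq, Rmult_0_r in M.
        assert (0 <= 2 * (s u / sigma) * (- (p u * q u))) by (apply Rmult_le_pos; lra).
        lra. }
  destruct (intermediate_zero p _ a b Hab Hp) as [z [Hz Ez]]; [nra|].
  assert (Epc : p c = 0) by (pose proof (Hmin z Hz); rewrite Ez in *; nra).
  assert (p b = 0); [|lra].
  apply (pendulum_rest s p q sigma g c b); auto; try lra;
    intros u Hu; first [apply Hs|apply Hp|apply Hq|apply Hr]; lra. }
(* Since [p] rises from a negative to a positive value, [q] is positive somewhere; having no zero,
   it keeps that sign. *)
destruct (mean_value p _ a b Hab Hp) as [c [Hc E]].
assert (Hqc : 0 < q c).
{ pose proof (Hs' c Hc). destruct (Rlt_dec 0 (q c)) as [H0|H0]; [exact H0|].
  assert (0 <= s c / sigma * (- q c)) by (apply Rmult_le_pos; lra). nra. }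
intros t Ht. destruct (Rlt_dec 0 (q t)) as [H0|H0]; [exact H0|exfalso].
destruct (Rtotal_order c t) as [H|[H|H]].
- destruct (intermediate_zero q (fun t => g * s t * sin (p t)) c t H) as [z [Hz Ez]].
  + intros u Hu; apply Hq; lra.
  + nra.
  + apply (Hnz z); [lra|exact Ez].
- subst; lra.
- destruct (intermediate_zero q (fun t => g * s t * sin (p t)) t c H) as [z [Hz Ez]].
  + intros u Hu; apply Hq; lra.
  + nra.
  + apply (Hnz z); [lra|exact Ez].
Qed.

(** * Change of parameter, and derivatives relative to a set *)

(** A point [u] at distance at least [e] from [t] has [f u] beyond [f (t + e)] or [f (t - e)], which
    are a fixed gap away from [f t]. If such a point falls outside the interval, that side imposes
    no condition and the radius 1 serves. *)
Lemma strictly_increasing_inverse_continuous (a b : R) (f : R -> R) (t e : R) :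
  (forall u v, Icc a b u -> Icc a b v -> u < v -> f u < f v) ->
  Icc a b t -> 0 < e ->
  exists d, 0 < d /\
    forall u, Icc a b u -> Rabs (f u - f t) < d -> Rabs (u - t) < e.
Proof.
intros Hf Ht He.
assert (Hr : exists d, 0 < d /\ forall u, Icc a b u -> f u - f t < d -> u - t < e).
{ destruct (Rle_dec (t + e) b) as [H|H].
  - assert (I : Icc a b (t + e)) by (unfold Icc in *; lra).
    exists (f (t + e) - f t). split; [pose proof (Hf t (t + e) Ht I); lra|].
    intros u Hu Hd. destruct (Rlt_dec (u - t) e) as [K|K]; [exact K|].
    destruct (Req_dec u (t + e)) as [E|E]; [rewrite E in Hd; lra|].
    pose proof (Hf (t + e) u I Hu). lra.
  - exists 1. split; [lra|]. intros u Hu _. unfold Icc in *; lra. }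
assert (Hl : exists d, 0 < d /\ forall u, Icc a b u -> f t - f u < d -> t - u < e).
{ destruct (Rle_dec a (t - e)) as [H|H].
  - assert (I : Icc a b (t - e)) by (unfold Icc in *; lra).
    exists (f t - f (t - e)). split; [pose proof (Hf (t - e) t I Ht); lra|].
    intros u Hu Hd. destruct (Rlt_dec (t - u) e) as [K|K]; [exact K|].
    destruct (Req_dec u (t - e)) as [E|E]; [rewrite E in Hd; lra|].
    pose proof (Hf u (t - e) Hu I). lra.
  - exists 1. split; [lra|]. intros u Hu _. unfold Icc in *; lra. }
destruct Hr as [d1 [Hd1 Hr]]. destruct Hl as [d2 [Hd2 Hl]].
exists (Rmin d1 d2). split; [now apply Rmin_glb_lt|].
intros u Hu Hd. pose proof (Rmin_l d1 d2). pose proof (Rmin_r d1 d2).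
apply Rabs_def2 in Hd. apply Rabs_def1.
- apply Hr; [exact Hu|lra].
- pose proof (Hl u Hu). lra.
Qed.

(** The difference quotient of [x] in the variable [psi] is the quotient of those of [X] and [psi]
    in [t]. Continuity of the inverse of [psi] carries the limit over to the range. *)
Lemma D_in_parametric (a b : R) (psi dpsi X dX x d : R -> R) (t : R) :
  (forall u v, Icc a b u -> Icc a b v -> u < v -> psi u < psi v) ->
  Icc a b t -> D_in psi dpsi (Icc a b) t -> D_in X dX (Icc a b) t ->
  dpsi t <> 0 -> (forall u, Icc a b u -> x (psi u) = X u) ->
  d (psi t) = dX t / dpsi t ->
  D_in x d (psi_range a b psi) (psi t).
Proof.
intros Hmono Ht Hp HX Hdpsi Hx Hd e He. rewrite Hd.
assert (L := limit_mul _ _ _ _ _ _ HX (limit_inv _ _ _ _ Hp Hdpsi)).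
destruct (L e He) as [d1 [Hd1 L1]].
destruct (strictly_increasing_inverse_continuous a b psi t d1 Hmono Ht Hd1)
  as [d2 [Hd2 L2]].
exists d2. split; [exact Hd2|].
intros p [[[u [Hu Ep]] Hne] Hpd]. subst p.
assert (Hut : u <> t) by congruence.
assert (K := L1 u (conj (conj Hu (not_eq_sym Hut)) (L2 u Hu Hpd))).
rewrite (Hx u Hu), (Hx t Ht).
replace ((X u - X t) / (psi u - psi t))
  with ((X u - X t) / (u - t) * / ((psi u - psi t) / (u - t)))
  by (field; split; lra).
exact K.
Qed.

(** Both values are limits at [t] of the same function on the interior. This serves to carry the
    differential equation, imposed on the open interval, to the end points. *)
Lemma continue_in_closure (a b : R) (f h : R -> R) (t : R) :
  a < b -> Icc a b t -> continue_in f (Icc a b) t -> continuity_pt h t ->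
  (forall u, a < u < b -> f u = h u) -> f t = h t.
Proof.
intros Hab Ht Hf Hh E.
apply (single_limit f (fun u => a < u < b /\ u <> t) (f t) (h t) t).
(* The point [t] is adherent to the punctured interior: step right if [t < b] and left if [t = b],
   halving the admissible length to stay strictly inside. *)
- intros e He. unfold Icc in Ht. destruct (Rlt_dec t b) as [H|H].
  + assert (P : 0 < Rmin e (b - t)) by (apply Rmin_glb_lt; lra).
    pose proof (Rmin_l e (b - t)). pose proof (Rmin_r e (b - t)).
    exists (t + Rmin e (b - t) / 2). split; [lra|].
    unfold R_dist. rewrite Rabs_pos_eq; lra.
  + assert (P : 0 < Rmin e (b - a)) by (apply Rmin_glb_lt; lra).
    pose proof (Rmin_l e (b - a)). pose proof (Rmin_r e (b - a)).
    exists (t - Rmin e (b - a) / 2). split; [lra|].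
    unfold R_dist. rewrite Rabs_left; lra.
- intros e He. destruct (Hf e He) as [d [Hd K]]. exists d; split; [exact Hd|].
  intros u [[Hu Hne] Hud]. apply K. split; [|exact Hud].
  split; [unfold Icc; lra|congruence].
- intros e He. destruct (Hh e He) as [d [Hd K]]. exists d; split; [exact Hd|].
  intros u [[Hu Hne] Hud]. rewrite (E u Hu). apply K. split; [|exact Hud].
  split; [exact I|congruence].
Qed.

Lemma D_in_is_derive (a b : R) (f d : R -> R) (D : R -> Prop) (t : R) :
  a < t < b -> (forall u, Icc a b u -> D u) -> D_in f d D t -> is_derive f t (d t).
Proof.
intros Ht HD H. apply is_derive_Reals, derivable_pt_lim_D_in.
intros e He. destruct (H e He) as [d1 [Hd1 K]].
exists (Rmin d1 (Rmin (t - a) (b - t))).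
pose proof (Rmin_l d1 (Rmin (t - a) (b - t))).
pose proof (Rmin_r d1 (Rmin (t - a) (b - t))).
pose proof (Rmin_l (t - a) (b - t)). pose proof (Rmin_r (t - a) (b - t)).
split; [repeat apply Rmin_glb_lt; lra|].
intros u [[_ Hu] Hd]. apply K. simpl in *. split; [|lra].
split; [|exact Hu]. apply HD. apply Rabs_def2 in Hd. unfold Icc; lra.
Qed.

Lemma D_in_ext (f h d : R -> R) (D : R -> Prop) (t : R) :
  (forall u, D u -> f u = h u) -> D t -> D_in f d D t -> D_in h d D t.
Proof.
intros E Ht H e He. destruct (H e He) as [d1 [Hd1 K]].
exists d1; split; [exact Hd1|]. intros u Hu.
rewrite <- (E u), <- (E t); [now apply K|exact Ht|apply Hu].
Qed.

(** * Speed and slope angle of a polar graph *)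

Lemma speed_pos (rho drho : R -> R) (t : R) :
  0 < rho t -> 0 < speed rho drho t.
Proof.
intros H. apply sqrt_lt_R0. pose proof (pow2_ge_0 (drho t)). nra.
Qed.

Lemma speed_sqr (rho drho : R -> R) (t : R) :
  speed rho drho t ^ 2 = rho t ^ 2 + drho t ^ 2.
Proof.
apply pow2_sqrt. pose proof (pow2_ge_0 (drho t)). pose proof (pow2_ge_0 (rho t)). lra.
Qed.

(** Both angles have the same sine and cosine and lie in an open window of length [PI], so the sine
    of their difference vanishes only if they coincide. *)
Lemma slope_angle_unique (a b : R) (rho drho p q : R -> R) (t : R) :
  slope_angle a b rho drho p -> slope_angle a b rho drho q -> Icc a b t ->
  p t = q t.
Proof.
intros Hp Hq Ht.
destruct (Hp t Ht) as [_ [Rp [Sp Cp]]]. destruct (Hq t Ht) as [_ [Rq [Sq Cq]]].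
assert (S : sin (p t - q t) = 0) by (rewrite sin_minus, Sp, Cp, Sq, Cq; ring).
destruct (Rtotal_order (p t) (q t)) as [H|[H|H]]; [|exact H|].
- assert (0 < sin (q t - p t)) by (apply sin_gt_0; lra).
  replace (q t - p t) with (- (p t - q t)) in * by ring.
  rewrite sin_neg in *. lra.
- assert (0 < sin (p t - q t)) by (apply sin_gt_0; lra). lra.
Qed.

Lemma sin_atan_speed (rho drho : R -> R) (t : R) :
  0 < rho t -> sin (atan (drho t / rho t)) = drho t / speed rho drho t.
Proof.
intros H. pose proof (speed_pos rho drho t H). pose proof (speed_sqr rho drho t) as E.
assert (Es : sqrt (1 + (drho t / rho t)²) = speed rho drho t / rho t).
{ rewrite <- (sqrt_pow2 (speed rho drho t / rho t)).
  - f_equal. unfold Rsqr.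
    replace ((speed rho drho t / rho t) ^ 2) with (speed rho drho t ^ 2 / rho t ^ 2)
      by (field; lra).
    rewrite E. field. lra.
  - left. now apply Rdiv_lt_0_compat. }
rewrite sin_atan, Es. field. lra.
Qed.

(** This is the derivative of [t - PI / 2 - atan (rho' / rho)], that is, the speed times the
    curvature of the polar graph. *)
Definition slope_rate (rho drho ddrho : R -> R) (t : R) : R :=
  (rho t ^ 2 + 2 * drho t ^ 2 - rho t * ddrho t) / (rho t ^ 2 + drho t ^ 2).

Lemma C2_on_extension (a b : R) (rho drho ddrho : R -> R) :
  a < b -> C2_on a b rho drho ddrho ->
  exists r r1 : R -> R, forall t, Icc a b t ->
    r t = rho t /\ r1 t = drho t /\
    is_derive r t (r1 t) /\ is_derive r1 t (ddrho t).
Proof.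
intros Hab HC.
destruct (derivable_extension a b rho drho Hab (fun t Ht => proj1 (HC t Ht)))
  as [r Hr].
destruct (derivable_extension a b drho ddrho Hab
  (fun t Ht => proj1 (proj2 (HC t Ht)))) as [r1 Hr1].
exists r, r1. intros t Ht.
destruct (Hr t Ht) as [E D]. destruct (Hr1 t Ht) as [E1 D1].
rewrite E1. auto.
Qed.

Lemma is_derive_slope (r r1 r2 : R -> R) (t : R) :
  0 < r t -> is_derive r t (r1 t) -> is_derive r1 t (r2 t) ->
  is_derive (fun u => u - PI / 2 - atan (r1 u / r u)) t (slope_rate r r1 r2 t).
Proof.
intros Hr D D1.
assert (P : 0 < r t ^ 2 + r1 t ^ 2) by (pose proof (pow2_ge_0 (r1 t)); nra).
evar_last.
- auto_derive; [|reflexivity]. repeat split; try lra; eexists; eassumption.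
- replace (Derive (fun x : R => r x) t) with (r1 t)
    by (symmetry; now apply is_derive_unique).
  replace (Derive (fun x : R => r1 x) t) with (r2 t)
    by (symmetry; now apply is_derive_unique).
  unfold slope_rate, Rsqr. field. split; [lra|]. simpl in P; nra.
Qed.

Lemma is_derive_inclination (r r1 r2 : R -> R) (t : R) :
  0 < r t -> is_derive r t (r1 t) -> is_derive r1 t (r2 t) ->
  is_derive (fun u => r1 u / speed r r1 u) t
    (r t * (r t * r2 t - r1 t ^ 2) / speed r r1 t ^ 3).
Proof.
intros Hr D D1.
assert (P : 0 < r t ^ 2 + r1 t ^ 2) by (pose proof (pow2_ge_0 (r1 t)); nra).
pose proof (speed_pos r r1 t Hr) as Hs. pose proof (speed_sqr r r1 t) as E.
evar_last.
- unfold speed. auto_derive; [|reflexivity].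
  change (0 < speed r r1 t) in Hs. unfold speed in Hs. simpl in P, Hs.
  repeat split; try lra; eexists; eassumption.
- replace (Derive (fun x : R => r x) t) with (r1 t)
    by (symmetry; now apply is_derive_unique).
  replace (Derive (fun x : R => r1 x) t) with (r2 t)
    by (symmetry; now apply is_derive_unique).
  change (sqrt (r t * (r t * 1) + r1 t * (r1 t * 1))) with (speed r r1 t).
  revert E Hs. generalize (speed r r1 t). intros s E Hs.
  (* Quotient rule with [s' = (r * r1 + r1 * r2) / s]; all that is kept of the square root [s] is
     its positivity and its square. *)
  transitivity ((r2 t * s ^ 2 - r1 t * (r t * r1 t + r1 t * r2 t)) / s ^ 3).
  + field. lra.
  + rewrite E. field. lra.
Qed.

Lemma is_derive_abscissa (r r1 : R -> R) (t : R) :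
  is_derive r t (r1 t) ->
  is_derive (fun u => r u * cos u) t (r1 t * cos t - r t * sin t).
Proof.
intros D. evar_last.
- auto_derive; [|reflexivity]. now exists (r1 t).
- replace (Derive (fun x : R => r x) t) with (r1 t)
    by (symmetry; now apply is_derive_unique). ring.
Qed.

Lemma is_derive_ordinate (r r1 : R -> R) (t : R) :
  is_derive r t (r1 t) ->
  is_derive (fun u => r u * sin u) t (r1 t * sin t + r t * cos t).
Proof.
intros D. evar_last.
- auto_derive; [|reflexivity]. now exists (r1 t).
- replace (Derive (fun x : R => r x) t) with (r1 t)
    by (symmetry; now apply is_derive_unique). ring.
Qed.

Lemma slope_angle_atan (a b : R) (rho drho ddrho psi : R -> R) (t : R) :
  C2_on a b rho drho ddrho -> positive_on a b rho ->
  slope_angle a b rho drho psi -> Icc a b t ->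
  psi t = t - PI / 2 - atan (drho t / rho t).
Proof.
intros HC Hpos Hpsi Ht.
exact (slope_angle_unique a b rho drho psi _ t Hpsi
         (slope_angle_exists a b rho drho ddrho HC Hpos) Ht).
Qed.

(** The arctangent formula, applied to extensions of [rho] and [drho], gives a function with
    two-sided derivatives that agrees with [psi] on the closed interval. *)
Lemma slope_angle_extension (a b : R) (rho drho ddrho psi : R -> R) :
  a < b -> C2_on a b rho drho ddrho -> positive_on a b rho ->
  slope_angle a b rho drho psi ->
  exists p : R -> R, forall t, Icc a b t ->
    p t = psi t /\ is_derive p t (slope_rate rho drho ddrho t).
Proof.
intros Hab HC Hpos Hpsi.
destruct (C2_on_extension a b rho drho ddrho Hab HC) as [r [r1 Hr]].
exists (fun u => u - PI / 2 - atan (r1 u / r u)). intros t Ht.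
destruct (Hr t Ht) as [E [E1 [D D1]]]. split.
- rewrite (slope_angle_atan a b rho drho ddrho psi t) by assumption.
  now rewrite E, E1.
- replace (slope_rate rho drho ddrho t) with (slope_rate r r1 ddrho t)
    by (unfold slope_rate; now rewrite E, E1).
  apply is_derive_slope; [rewrite E; now apply Hpos|exact D|exact D1].
Qed.

(** * (EL) as a first-order equation for the slope angle *)

Lemma EL_equation_slope_rate (a b g sigma P0 : R) (rho drho ddrho : R -> R) (t : R) :
  C2_on a b rho drho ddrho -> positive_on a b rho -> a < t < b ->
  g * rho t ^ 2 * sin t + sigma * (rho t / speed rho drho t)
  - sigma * Derive (fun s => drho s / speed rho drho s) t - P0 * rho t
  = rho t * (sigma * slope_rate rho drho ddrho t / speed rho drho t
             - (P0 - g * (rho t * sin t))).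
Proof.
intros HC Hpos Ht.
assert (Hi : Icc a b t) by (unfold Icc; lra).
destruct (HC t Hi) as [D [D1 _]].
apply (D_in_is_derive a b) in D; [|exact Ht|auto].
apply (D_in_is_derive a b) in D1; [|exact Ht|auto].
pose proof (Hpos t Hi) as Hr. pose proof (speed_pos rho drho t Hr) as Hs.
replace (Derive (fun s => drho s / speed rho drho s) t)
  with (rho t * (rho t * ddrho t - drho t ^ 2) / speed rho drho t ^ 3)
  by (symmetry; apply is_derive_unique; now apply is_derive_inclination).
unfold slope_rate. pose proof (speed_sqr rho drho t) as E. rewrite <- E.
revert Hs E. generalize (speed rho drho t). intros s Hs E.
apply Rminus_diag_uniq.
(* For a free variable [s] the two sides differ by a multiple of [s ^ 2 - (rho ^ 2 + drho ^ 2)],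
   which vanishes for the speed. *)
transitivity (sigma * rho t * (s ^ 2 - (rho t ^ 2 + drho t ^ 2)) / s ^ 3).
- field. lra.
- rewrite E. field. lra.
Qed.

Lemma EL_equation_iff (a b g sigma P0 : R) (rho drho ddrho : R -> R) (t : R) :
  0 < sigma -> C2_on a b rho drho ddrho -> positive_on a b rho -> a < t < b ->
  g * rho t ^ 2 * sin t + sigma * (rho t / speed rho drho t)
  - sigma * Derive (fun s => drho s / speed rho drho s) t - P0 * rho t = 0
  <-> slope_rate rho drho ddrho t
      = speed rho drho t / sigma * (P0 - g * (rho t * sin t)).
Proof.
intros Hsig HC Hpos Ht.
rewrite (EL_equation_slope_rate a b g sigma P0 rho drho ddrho t HC Hpos Ht).
assert (Hr : 0 < rho t) by (apply Hpos; unfold Icc; lra).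
pose proof (speed_pos rho drho t Hr) as Hs. split; intros H.
- apply Rmult_integral in H. destruct H as [H|H]; [lra|].
  replace (P0 - g * (rho t * sin t))
    with (sigma * slope_rate rho drho ddrho t / speed rho drho t) by lra.
  field. lra.
- rewrite H. field. lra.
Qed.

(** The left quotient is the sine of the arctangent, and the sine is injective on the closed
    interval from [- (PI / 2)] to [PI / 2]. *)
Lemma inclination_iff (rho drho : R -> R) (t gam : R) :
  0 < rho t -> - (PI / 2) <= gam <= PI / 2 ->
  drho t / speed rho drho t = sin gam <-> atan (drho t / rho t) = gam.
Proof.
intros Hr Hg. rewrite <- (sin_atan_speed rho drho t Hr).
split; [|now intros ->]. intros H. apply sin_inj; [|exact Hg|exact H].
pose proof (atan_bound (drho t / rho t)). lra.
Qed.

Lemma slope_rate_closure (a b g sigma P0 : R) (rho drho ddrho : R -> R) (t : R) :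
  a < b -> C2_on a b rho drho ddrho -> positive_on a b rho ->
  (forall u, a < u < b -> slope_rate rho drho ddrho u
     = speed rho drho u / sigma * (P0 - g * (rho u * sin u))) ->
  Icc a b t ->
  slope_rate rho drho ddrho t
     = speed rho drho t / sigma * (P0 - g * (rho t * sin t)).
Proof.
intros Hab HC Hpos H Ht.
destruct (C2_on_extension a b rho drho ddrho Hab HC) as [r [r1 Hr]].
(* The rate equation solved for the second derivative: [h] is continuous up to the end points and
   equals the continuous [ddrho] inside. *)
set (h := fun u => (r u ^ 2 + 2 * r1 u ^ 2
  - speed r r1 u / sigma * (P0 - g * (r u * sin u)) * (r u ^ 2 + r1 u ^ 2)) / r u).
assert (E : ddrho t = h t).
{ apply (continue_in_closure a b); try assumption.
  - now apply HC.
  - destruct (Hr t Ht) as [E [_ [D D1]]].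
    assert (P : 0 < r t) by (rewrite E; now apply Hpos).
    apply continuity_pt_filterlim, (ex_derive_continuous h).
    unfold h, speed. auto_derive.
    pose proof (pow2_ge_0 (r1 t)). simpl in *.
    repeat split; try nra; eexists; eassumption.
  - intros u Hu. assert (Hi : Icc a b u) by (unfold Icc; lra).
    destruct (Hr u Hi) as [E [E1 _]]. pose proof (Hpos u Hi).
    unfold h. replace (speed r r1 u) with (speed rho drho u)
      by (unfold speed; now rewrite E, E1).
    rewrite E, E1, <- (H u Hu). unfold slope_rate. field.
    pose proof (pow2_ge_0 (drho u)). nra. }
destruct (Hr t Ht) as [Er [Er1 _]]. pose proof (Hpos t Ht).
unfold slope_rate. rewrite E. unfold h.
replace (speed r r1 t) with (speed rho drho t)
  by (unfold speed; now rewrite Er, Er1).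
rewrite Er, Er1.
assert (rho t ^ 2 + drho t ^ 2 <> 0) by (pose proof (pow2_ge_0 (drho t)); nra).
generalize (speed rho drho t / sigma * (P0 - g * (rho t * sin t))). intros z.
field. split; [|lra]. simpl in *; nra.
Qed.

(** * Positive curvature and monotonicity of the slope angle *)

(** By the rate equation [P0 - g * y] is [sigma] times the curvature. Together with the slope angle
    it forms the pendulum; [0 < a] and [b < PI] turn the window [t - PI < psi t < t] into the bound
    [- PI < psi t < PI]. *)
Lemma curvature_pos (a b g sigma P0 : R) (rho drho ddrho psi : R -> R) :
  0 < sigma -> 0 < g -> 0 < a -> a < b -> b < PI ->
  C2_on a b rho drho ddrho -> positive_on a b rho ->
  slope_angle a b rho drho psi ->
  (forall t, Icc a b t -> slope_rate rho drho ddrho t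
     = speed rho drho t / sigma * (P0 - g * (rho t * sin t))) ->
  psi a < 0 < psi b ->
  forall t, Icc a b t -> 0 < P0 - g * (rho t * sin t).
Proof.
intros Hsig Hg Ha Hab Hb HC Hpos Hpsi Hrate Hends t Ht.
destruct (C2_on_extension a b rho drho ddrho Hab HC) as [r [r1 Hr]].
destruct (slope_angle_extension a b rho drho ddrho psi Hab HC Hpos Hpsi) as [p Hp].
assert (Es : forall u, Icc a b u -> speed r r1 u = speed rho drho u).
{ intros u Hu. destruct (Hr u Hu) as [E [E1 _]]. unfold speed; now rewrite E, E1. }
rewrite <- (proj1 (Hr t Ht)).
apply (pendulum_monotone (speed r r1) p (fun u => P0 - g * (r u * sin u))
         sigma g a b); try assumption.
- intros u Hu. destruct (Hr u Hu) as [E [_ [D D1]]].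
  assert (P : 0 < r u) by (rewrite E; now apply Hpos).
  split; [now apply speed_pos|].
  apply continuity_pt_filterlim, (ex_derive_continuous (speed r r1)).
  unfold speed. auto_derive. pose proof (pow2_ge_0 (r1 u)). simpl in *.
  repeat split; try nra; eexists; eassumption.
- intros u Hu. rewrite (Es u Hu), (proj1 (Hr u Hu)), <- (Hrate u Hu). now apply Hp.
- intros u Hu. destruct (Hr u Hu) as [E [E1 [D _]]].
  destruct (Hp u Hu) as [Ep _]. destruct (Hpsi u Hu) as [_ [_ [S _]]].
  pose proof (speed_pos rho drho u (Hpos u Hu)).
  evar_last.
  + apply (is_derive_minus (fun _ => P0) (fun v => g * (r v * sin v)));
      [apply is_derive_const|].
    apply (is_derive_scal (fun v => r v * sin v)).
    apply is_derive_ordinate, D.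
  (* The derivative of [- g * y] is [- g * (rho' * sin u + rho * cos u)], which is [g * s * sin psi]
     by the sine formula of the slope angle. *)
  + rewrite Ep, S, (Es u Hu), E, E1.
    unfold minus, plus, opp, zero, scal; simpl; unfold mult; simpl.
    field. lra.
- intros u Hu. rewrite (proj1 (Hp u Hu)). destruct (Hpsi u Hu) as [_ [Rg _]].
  unfold Icc in *; lra.
- rewrite (proj1 (Hp a ltac:(unfold Icc; lra))), (proj1 (Hp b ltac:(unfold Icc; lra))).
  exact Hends.
Qed.

Lemma slope_strictly_increasing (a b : R) (rho drho ddrho psi : R -> R) :
  a < b -> C2_on a b rho drho ddrho -> positive_on a b rho ->
  slope_angle a b rho drho psi ->
  (forall t, Icc a b t -> 0 < slope_rate rho drho ddrho t) ->
  forall u v, Icc a b u -> Icc a b v -> u < v -> psi u < psi v.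
Proof.
intros Hab HC Hpos Hpsi Hrate u v Hu Hv Huv.
destruct (slope_angle_extension a b rho drho ddrho psi Hab HC Hpos Hpsi) as [p Hp].
rewrite <- (proj1 (Hp u Hu)), <- (proj1 (Hp v Hv)).
destruct (mean_value p (slope_rate rho drho ddrho) u v Huv) as [c [Hc E]].
- intros t Ht. apply Hp. unfold Icc in *; lra.
- pose proof (Hrate c ltac:(unfold Icc in *; lra)). nra.
Qed.

(** * Passage between (EL) and the system in the slope angle *)

(** Applied to the slope angle, this recovers the polar angle, so that the curve can be written in
    terms of [psi]. Off the range of [f] the value chosen is arbitrary. *)
Lemma injective_on_left_inverse (a b : R) (f : R -> R) :
  injective_on a b f -> exists h : R -> R, forall t, Icc a b t -> h (f t) = t.
Proof.
intros Hf.
exists (fun p => ClassicalEpsilon.epsilon (inhabits 0) (fun t => Icc a b t /\ f t = p)).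
intros t Ht.
destruct (ClassicalEpsilon.epsilon_spec (inhabits 0)
  (fun u => Icc a b u /\ f u = f t)) as [Hu E]; [now exists t|].
now apply Hf.
Qed.

(** With [a = theta2] and [b = PI - theta1] the right-hand angles are [psi2] and [psi1]. At [b] the
    minus sign is absorbed by replacing [gam] with [- gam]. *)
Lemma EL_boundary_iff (a b gam : R) (rho drho ddrho psi : R -> R) :
  a < b -> C2_on a b rho drho ddrho -> positive_on a b rho ->
  slope_angle a b rho drho psi -> - (PI / 2) <= gam <= PI / 2 ->
  (drho a / speed rho drho a = sin gam <-> psi a = a - PI / 2 - gam) /\
  (drho b / speed rho drho b = - sin gam <-> psi b = b - PI / 2 + gam).
Proof.
intros Hab HC Hpos Hpsi Hg.
assert (Ha : Icc a b a) by (unfold Icc; lra).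
assert (Hb : Icc a b b) by (unfold Icc; lra).
rewrite (slope_angle_atan a b rho drho ddrho psi a),
  (slope_angle_atan a b rho drho ddrho psi b) by assumption.
rewrite <- sin_neg, inclination_iff, inclination_iff by (try apply Hpos; lra || assumption).
lra.
Qed.

(** Stated for every [x], [y] that parametrize the curve by [psi], so that it yields both the
    solution of the system and one direction of the equivalence. *)
Lemma EL_psi_system (g sigma theta1 theta2 jump gam P0 : R)
    (rho drho ddrho psi : R -> R) :
  0 < g -> 0 < sigma -> 0 < theta1 -> 0 < theta2 -> theta1 + theta2 < PI ->
  - (PI / 2) <= gam <= PI / 2 -> sin gam = - (jump / sigma) ->
  0 < gam + PI / 2 - theta1 -> - gam - PI / 2 + theta2 < 0 ->
  C2_on theta2 (PI - theta1) rho drho ddrho ->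
  positive_on theta2 (PI - theta1) rho ->
  slope_angle theta2 (PI - theta1) rho drho psi ->
  EL g sigma jump theta1 theta2 P0 rho drho ->
  injective_on theta2 (PI - theta1) psi /\
  forall x y : R -> R, psi_param theta2 (PI - theta1) rho psi x y ->
    psi_system g sigma theta1 theta2 (gam + PI / 2 - theta1)
      (- gam - PI / 2 + theta2) P0 psi x y.
Proof.
intros Hg Hsig H1 H2 H12 Hgam Hsin Hp1 Hp2 HC Hpos Hpsi [Heq [Hl Hr]].
assert (Hab : theta2 < PI - theta1) by lra.
set (a := theta2) in *. set (b := PI - theta1) in *.
destruct (EL_boundary_iff a b gam rho drho ddrho psi Hab HC Hpos Hpsi Hgam)
  as [Ba Bb].
assert (Ea : psi a = - gam - PI / 2 + theta2).
{ rewrite (proj1 Ba); [unfold a; ring|lra]. }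
assert (Eb : psi b = gam + PI / 2 - theta1).
{ rewrite (proj1 Bb); [unfold b; field|lra]. }
assert (Hrate : forall t, Icc a b t -> slope_rate rho drho ddrho t
     = speed rho drho t / sigma * (P0 - g * (rho t * sin t))).
{ intros t. apply slope_rate_closure; try assumption.
  intros u Hu. apply (EL_equation_iff a b); auto. }
assert (HQ : forall t, Icc a b t -> 0 < P0 - g * (rho t * sin t)).
{ apply (curvature_pos a b g sigma P0 rho drho ddrho psi); auto; lra. }
assert (Hs : forall t, Icc a b t -> 0 < speed rho drho t).
{ intros t Ht. now apply speed_pos, Hpos. }
assert (Hrate0 : forall t, Icc a b t -> 0 < slope_rate rho drho ddrho t).
{ intros t Ht. rewrite (Hrate t Ht). apply Rmult_lt_0_compat; [|now apply HQ].
  apply Rdiv_lt_0_compat; auto. }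
assert (Hmono := slope_strictly_increasing a b rho drho ddrho psi
                   Hab HC Hpos Hpsi Hrate0).
split.
{ intros u v Hu Hv E. destruct (Rtotal_order u v) as [H|[H|H]]; [|exact H|].
  - pose proof (Hmono u v Hu Hv H); lra.
  - pose proof (Hmono v u Hv Hu H); lra. }
intros x y Hxy. split; [|now split].
destruct (C2_on_extension a b rho drho ddrho Hab HC) as [r [r1 Hr0]].
destruct (slope_angle_extension a b rho drho ddrho psi Hab HC Hpos Hpsi) as [p Hp].
intros q [t [Ht Eq]]. subst q. change (Icc a b t) in Ht.
destruct (Hxy t Ht) as [Ex Ey]. pose proof (HQ t Ht) as Q. pose proof (Hs t Ht) as S.
destruct (Hr0 t Ht) as [E [E1 [D _]]].
destruct (Hpsi t Ht) as [_ [_ [Sp Cp]]].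
assert (Dpsi : D_in psi (slope_rate rho drho ddrho) (Icc a b) t).
{ apply (D_in_ext p); [intros; now apply Hp|exact Ht|].
  apply is_derive_D_in. now apply Hp. }
pose proof (Hrate0 t Ht) as R0.
split; [rewrite Ey; lra|split].
- apply (D_in_parametric a b psi (slope_rate rho drho ddrho)
    (fun u => r u * cos u) (fun u => r1 u * cos u - r u * sin u)); auto; try lra.
  + apply is_derive_D_in, is_derive_abscissa, D.
  + intros u Hu. now rewrite (proj1 (Hr0 u Hu)), (proj1 (Hxy u Hu)).
  (* The quotient [x' / psi'] is [- s * cos psi] over [s / sigma * (P0 - g * y)]; the speed
     cancels. *)
  + rewrite Ey, Cp, (Hrate t Ht), E, E1. field. repeat split; lra.
- apply (D_in_parametric a b psi (slope_rate rho drho ddrho)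
    (fun u => r u * sin u) (fun u => r1 u * sin u + r u * cos u)); auto; try lra.
  + apply is_derive_D_in, is_derive_ordinate, D.
  + intros u Hu. now rewrite (proj1 (Hr0 u Hu)), (proj2 (Hxy u Hu)).
  + rewrite Ey, Sp, (Hrate t Ht), E, E1. field. repeat split; lra.
Qed.

(** The composite of [x] and [psi] agrees with [X] on the interval, and derivatives at an interior
    point are unique. *)
Lemma psi_range_chain_rule (a b : R) (X x d psi dpsi : R -> R) (t l : R) :
  a < t < b -> is_derive X t l ->
  (forall u, Icc a b u -> x (psi u) = X u) ->
  D_in psi dpsi (Icc a b) t -> D_in x d (psi_range a b psi) (psi t) ->
  l = dpsi t * d (psi t).
Proof.
intros Ht HX E Hpsi Hx.
assert (Hi : Icc a b t) by (unfold Icc; lra).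
assert (H := Dcomp _ _ _ _ _ _ _ Hpsi Hx).
(* The composite is differentiated relative to the domain [Dgf], which contains the whole interval
   because [psi] maps it into its range. *)
assert (HD : forall u, Icc a b u -> Dgf (Icc a b) (psi_range a b psi) psi u).
{ intros u Hu. split; [exact Hu|now exists u]. }
apply (D_in_ext _ X) in H; [|intros u [Hu _]; now apply E|now apply HD].
apply (D_in_is_derive a b _ _ _ t Ht HD) in H.
transitivity (Derive X t); [symmetry|]; now apply is_derive_unique.
Qed.

Lemma psi_system_EL (g sigma theta1 theta2 jump gam P0 : R)
    (rho drho ddrho psi x y : R -> R) :
  0 < sigma -> theta1 + theta2 < PI ->
  - (PI / 2) <= gam <= PI / 2 -> sin gam = - (jump / sigma) ->
  C2_on theta2 (PI - theta1) rho drho ddrho ->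
  positive_on theta2 (PI - theta1) rho ->
  slope_angle theta2 (PI - theta1) rho drho psi ->
  psi_param theta2 (PI - theta1) rho psi x y ->
  psi_system g sigma theta1 theta2 (gam + PI / 2 - theta1)
    (- gam - PI / 2 + theta2) P0 psi x y ->
  EL g sigma jump theta1 theta2 P0 rho drho.
Proof.
intros Hsig H12 Hgam Hsin HC Hpos Hpsi Hxy [Hsys [Eb Ea]].
assert (Hab : theta2 < PI - theta1) by lra.
set (a := theta2) in *. set (b := PI - theta1) in *.
destruct (EL_boundary_iff a b gam rho drho ddrho psi Hab HC Hpos Hpsi Hgam)
  as [Ba Bb].
split; [|split].
- intros t Ht. change (a < t < b) in Ht.
  assert (Hi : Icc a b t) by (unfold Icc; lra).
  apply (EL_equation_iff a b g sigma P0 rho drho ddrho t Hsig HC Hpos Ht).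
  destruct (C2_on_extension a b rho drho ddrho Hab HC) as [r [r1 Hr]].
  destruct (slope_angle_extension a b rho drho ddrho psi Hab HC Hpos Hpsi) as [p Hp].
  destruct (Hr t Hi) as [E [E1 [D _]]].
  destruct (Hpsi t Hi) as [_ [_ [Sp Cp]]].
  assert (Dpsi : D_in psi (slope_rate rho drho ddrho) (Icc a b) t).
  { apply (D_in_ext p); [intros; now apply Hp|exact Hi|].
    apply is_derive_D_in. now apply Hp. }
  destruct (Hsys (psi t)) as [Hw [Dx Dy]]; [now exists t|].
  assert (Lx := psi_range_chain_rule a b (fun u => r u * cos u) x _ psi _ t _ Ht
    (is_derive_abscissa r r1 t D)
    ltac:(intros u Hu; cbv beta; now rewrite (proj1 (Hr u Hu)), (proj1 (Hxy u Hu))) Dpsi Dx).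
  assert (Ly := psi_range_chain_rule a b (fun u => r u * sin u) y _ psi _ t _ Ht
    (is_derive_ordinate r r1 t D)
    ltac:(intros u Hu; cbv beta; now rewrite (proj1 (Hr u Hu)), (proj2 (Hxy u Hu))) Dpsi Dy).
  cbv beta in Lx, Ly. rewrite (proj2 (Hxy t Hi)) in *. rewrite E, E1 in *.
  pose proof (speed_pos rho drho t (Hpos t Hi)) as S.
  set (s := speed rho drho t) in *. set (w := g * (rho t * sin t) - P0) in *.
  replace (drho t * cos t - rho t * sin t) with (- s * cos (psi t)) in Lx
    by (rewrite Cp; field; lra).
  replace (drho t * sin t + rho t * cos t) with (- s * sin (psi t)) in Ly
    by (rewrite Sp; field; lra).
  pose proof (sin2_cos2 (psi t)) as T. unfold Rsqr in T.
  (* Multiplying [Lx] by [cos psi] and [Ly] by [sin psi] and adding avoids a division by a sine or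
     cosine that may vanish. *)
  assert (K : - s = slope_rate rho drho ddrho t * (sigma / w)).
  { transitivity (- s * cos (psi t) * cos (psi t) + - s * sin (psi t) * sin (psi t)).
    - replace (- s) with (- s * 1) at 1 by ring. rewrite <- T. ring.
    - rewrite Lx, Ly.
      replace (slope_rate rho drho ddrho t * (sigma / w))
        with (slope_rate rho drho ddrho t * (sigma / w) * 1) by ring.
      rewrite <- T. field. exact Hw. }
  replace (P0 - g * (rho t * sin t)) with (- w) by (unfold w; ring).
  replace s with (- (- s)) by ring. rewrite K. field. split; [exact Hw|lra].
- rewrite (proj2 Ba); [exact Hsin|]. rewrite Ea. unfold a; ring.
- change (drho b / speed rho drho b = jump / sigma).
  rewrite (proj2 Bb); [rewrite Hsin; ring|]. rewrite Eb. unfold b; field.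
Qed.

Theorem theorem1p1
  (g sigma theta1 theta2 jump gam psi1 psi2 : R)
  (hg : 0 < g) (hsigma : 0 < sigma)
  (htheta1 : 0 < theta1 < PI) (htheta2 : 0 < theta2 < PI)
  (htheta : theta1 + theta2 < PI)
  (hjump : -1 <= jump / sigma <= 1)
  (hgam : - (PI / 2) <= gam <= PI / 2)
  (hsin : sin gam = - (jump / sigma))
  (hpsi1 : psi1 = gam + PI / 2 - theta1)
  (hpsi2 : psi2 = - gam - PI / 2 + theta2)
  (hpsi1_pos : 0 < psi1) (hpsi2_neg : psi2 < 0) :
  (forall (P0 : R) (rho drho ddrho psi : R -> R),
     C2_on theta2 (PI - theta1) rho drho ddrho ->
     positive_on theta2 (PI - theta1) rho ->
     slope_angle theta2 (PI - theta1) rho drho psi ->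
     EL g sigma jump theta1 theta2 P0 rho drho ->
     injective_on theta2 (PI - theta1) psi /\
     exists x y : R -> R,
       psi_param theta2 (PI - theta1) rho psi x y /\
       psi_system g sigma theta1 theta2 psi1 psi2 P0 psi x y)
  /\
  (forall (P0 : R) (rho drho ddrho psi x y : R -> R),
     C2_on theta2 (PI - theta1) rho drho ddrho ->
     positive_on theta2 (PI - theta1) rho ->
     slope_angle theta2 (PI - theta1) rho drho psi ->
     injective_on theta2 (PI - theta1) psi ->
     psi_param theta2 (PI - theta1) rho psi x y ->
     (EL g sigma jump theta1 theta2 P0 rho drho <->
      psi_system g sigma theta1 theta2 psi1 psi2 P0 psi x y)).
Proof.
subst psi1 psi2. split.
- intros P0 rho drho ddrho psi HC Hpos Hpsi HEL.
  destruct (EL_psi_system g sigma theta1 theta2 jump gam P0 rho drho ddrho psi)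
    as [Hinj Hsys]; auto; try lra.
  split; [exact Hinj|].
  destruct (injective_on_left_inverse _ _ _ Hinj) as [h Hh].
  (* Here [h] sends a slope angle back to its polar angle, so these are the Cartesian coordinates of
     the curve at slope angle [p]. *)
  exists (fun p => rho (h p) * cos (h p)), (fun p => rho (h p) * sin (h p)).
  assert (Hxy : psi_param theta2 (PI - theta1) rho psi
    (fun p => rho (h p) * cos (h p)) (fun p => rho (h p) * sin (h p))).
  { intros t Ht. now rewrite (Hh t Ht). }
  split; [exact Hxy|now apply Hsys].
- intros P0 rho drho ddrho psi x y HC Hpos Hpsi Hinj Hxy. split.
  + intros HEL.
    apply (EL_psi_system g sigma theta1 theta2 jump gam P0 rho drho ddrho psi);
      auto; lra.
  + apply (psi_system_EL g sigma theta1 theta2 jump gam P0 rho drho ddrho psi x y);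
      auto.
Qed.
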